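(* Let $(\mathcal D,\mathcal I,i^\star)$ be an identification task, let $H:\mathcal D\to\mathbb R^+$ be an arbitrary function and let $T\ge 1$ be an integer. Let $\mu,\lambda\in\mathcal D$ be such that $i^\star(\lambda)\ne i^\star(\mu)$ and $H(\lambda)\le\sqrt T$. Then for any algorithm $\mathcal A$ with horizon $T$, $$R_{H,T}(\mathcal A,\lambda)^{-1}\,(1-p_{\mu,T}(\mathcal A))-\frac{\log 2}{\sqrt T}\;\le\; H(\lambda)\sum_{k=1}^K\mathbb E_{\mu}\Big[\frac{N_{T,k}}{T}\Big]\mathrm{KL}(\mu_k,\lambda_k).$$
   Context: Setting (fixed budget bandit identification). There are $K\ge 1$ arms. For each arm $k\in[K]=\{1,\dots,K\}$ a one-parameter canonical exponential family of real distributions is fixed; its members are identified with their means, which range over an open interval $\mathcal M_k$. For $x,y\in\mathcal M_k$, $\mathrm{KL}(x,y)$ is the Kullback-Leibler divergence from the member with mean $x$ to the member with mean $y$. A bandit problem is identified with its mean vector $\mu\in\mathcal M_1\times\dots\times\mathcal M_K$. An identification task $(\mathcal D,\mathcal I,i^\star)$ consists of a finite answer set $\mathcal I$, a set $\mathcal D\subseteq\mathcal M_1\times\dots\times\mathcal M_K$, and a function $i^\star:\mathcal D\to\mathcal I$ such that, with $\mathcal D_i=\{\mu\in\mathcal D: i^\star(\mu)=i\}$, each $\mathcal D_i$ is open and equals the interior of its closure, and $\bigcup_{i}\mathrm{cl}(\mathcal D_i)\supseteq\mathcal M_1\times\dots\times\mathcal M_K$. An algorithm with horizon $T$: at each time $t=1,\dots,T$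 it chooses an arm $k_t$ based on the previous observations and observes an independent sample from the distribution of arm $k_t$; after time $T$ it returns an answer $\hat i_T\in\mathcal I$ based on the observations. $N_{T,k}$ is the number of times $t\le T$ with $k_t=k$. $\mathbb E_\mu$ is the expectation when the algorithm interacts with problem $\mu$. The error probability is $p_{\mu,T}(\mathcal A)=\mathbb P_{\mu,\mathcal A}(\hat i_T\ne i^\star(\mu))$. Difficulty ratio: $R_{H,T}(\mathcal A,\mu)=\dfrac{T}{H(\mu)\log(1/p_{\mu,T}(\mathcal A))}\in[0,\infty]$, i.e. $R_{H,T}(\mathcal A,\mu)^{-1}=H(\mu)\log(1/p_{\mu,T}(\mathcal A))/T$, with the conventions $\log(1/0)=\infty$, $0\cdot\infty=0$, $1/0=\infty$, $1/\infty=0$. *)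

(* Defs.v *)
From HB Require Import structures.
From mathcomp Require Import all_boot all_order all_algebra.
From mathcomp Require Import all_classical all_reals all_analysis.
From mathcomp Require Import measurable_realfun.

Set Implicit Arguments.
Unset Strict Implicit.
Unset Printing Implicit Defensive.

Import Order.TTheory GRing.Theory Num.Theory.
Import numFieldNormedType.Exports.

Local Open Scope classical_set_scope.
Local Open Scope ring_scope.

Section KullbackLeibler.
Local Open Scope ereal_scope.
Local Open Scope charge_scope.

Definition kl d (X : measurableType d) (R : realType) (P Q : probability X R) :
    \bar R :=
  if `[< P `<< Q >]
  then \int[P]_x lne (('d (charge_of_finite_measure P) '/d Q) x)
  else +oo.

End KullbackLeibler.

(* A one-parameter canonical exponential family, presented in its mean
   parametrization: for m in ef_means, ef_law m is the member with mean m, and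
   its density with respect to ef_base is x |-> exp (theta x - b(theta)) at the
   natural parameter theta = ef_nat m, where b = ef_logpart.  The values of
   ef_nat and ef_law outside ef_means are junk.  The base measure is
   automatically sigma-finite, the densities being positive and integrable.  *)
Record exp_family (R : realType) := ExpFamily {
  ef_base : {measure set R -> \bar R} ;
  ef_means : set R ;
  ef_nat : R -> R ;
  ef_logpart : R -> R ;
  ef_law : R -> probability R R ;
  ef_means_open : open ef_means ;
  ef_means_itv : is_interval ef_means ;
  ef_means_neq0 : ef_means !=set0 ;
  (* a finite value of the expectation entails integrability *)
  ef_law_mean : forall m, ef_means m -> ('E_(ef_law m)[idfun] = m%:E)%E ;
  ef_law_density : forall m, ef_means m ->
    forall A : set R, measurable A ->
      (ef_law m A =
       \int[ef_base]_(x in A)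
         (expR (ef_nat m * x - ef_logpart (ef_nat m)))%:E)%E
}.

Definition ef_kl (R : realType) (F : exp_family R) (x y : R) : \bar R :=
  kl (ef_law F x) (ef_law F y).

Definition mean_box (R : realType) (K : nat) (F : 'I_K -> exp_family R) :
    set 'rV[R]_K :=
  [set mu | forall k, ef_means (F k) (mu ord0 k)].

(* The answer function is only meaningful on the domain, so it is a total
   function and the regions D_i are cut out inside the domain.  Openness,
   closure and interior are taken in R^K; since mean_box F is an open box, they
   give the same conditions as the topology of mean_box F.  *)
Definition answer_region (R : realType) (K : nat) (I : finType)
    (D : set 'rV[R]_K) (istar : 'rV[R]_K -> I) (i : I) : set 'rV[R]_K :=
  [set mu | D mu /\ istar mu = i].

Record id_task (R : realType) (K : nat) (F : 'I_K -> exp_family R)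
    (I : finType) := IdTask {
  id_dom : set 'rV[R]_K ;
  id_answer : 'rV[R]_K -> I ;
  id_dom_sub : id_dom `<=` mean_box F ;
  id_region_open : forall i, open (answer_region id_dom id_answer i) ;
  id_region_regular : forall i,
    answer_region id_dom id_answer i
    = interior (closure (answer_region id_dom id_answer i)) ;
  id_region_cover :
    mean_box F `<=` \bigcup_(i in [set: I])
                       closure (answer_region id_dom id_answer i)
}.

(* What the algorithm knows after t rounds: the value u : U of its internal
   randomization followed by the observations x_1, ..., x_t, encoded as
   ((u, x_1), ..., x_t).  *)
Fixpoint hist_display (d : measure_display) (t : nat) : measure_display :=
  if t is s.+1 then
    measure_prod_display (hist_display d s, default_measure_display)
  else d.

Fixpoint hist (R : realType) d (U : measurableType d) (t : nat) :
    measurableType (hist_display d t) :=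
  match t return measurableType (hist_display d t) with
  | 0 => U
  | s.+1 => (hist R U s * R)%type : measurableType _
  end.

(* alg_arm s gives the arm pulled at time s + 1 from what is known after s
   rounds; only s < T matters.  Arms pulled earlier are functions of the
   history, hence need not be recorded in it.  Algorithms without internal
   randomization are the case of a one-point U.  *)
Record algorithm (R : realType) (K : nat) (I : finType) d
    (U : measurableType d) (T : nat) := Algorithm {
  alg_seed : probability U R ;
  alg_arm : forall s, hist R U s -> 'I_K ;
  alg_answer : hist R U T -> I ;
  alg_arm_measurable : forall s k, measurable (@alg_arm s @^-1` [set k]) ;
  alg_answer_measurable : forall i, measurable (alg_answer @^-1` [set i])
}.

(* The joint law of (h, x) where h ~ P and, given h, x ~ Q (a h).  The unused
   measurability argument of extend_law is what makes it a probability.  *)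
Section ExtendLaw.
Local Open Scope ereal_scope.
Context d d' (X : measurableType d) (Y : measurableType d') (R : realType).
Context (K : nat) (P : probability X R) (Q : 'I_K -> probability Y R).
Context (a : X -> 'I_K) (ma : forall k, measurable (a @^-1` [set k])).

Definition extend_law of (forall k, measurable (a @^-1` [set k])) :=
  fun A : set (X * Y) => \int[P]_h Q (a h) (xsection A h).

Local Notation ext := (extend_law ma).

Let measurable_slice (A : set (X * Y)) : measurable A ->
  measurable_fun [set: X] (fun h => Q (a h) (xsection A h)).
Proof.
move=> mA _ B mB; rewrite setTI.
rewrite (_ : _ @^-1` B = \bigcup_(k in [set: 'I_K])
   (a @^-1` [set k] `&` (fun h => Q k (xsection A h)) @^-1` B)); last first.
  apply/seteqP; split => [h /= Bh|h [k _] /= [<-//]].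
  by exists (a h).
apply: fin_bigcup_measurable => // k _; apply: measurableI => //.
by rewrite -[X in measurable X]setTI; exact: measurable_fun_xsection.
Qed.

Let ext0 : ext set0 = 0.
Proof. by apply: integral0_eq => h _; rewrite xsection0 measure0. Qed.

Let ext_ge0 A : 0 <= ext A.
Proof. by apply: integral_ge0 => h _; exact: measure_ge0. Qed.

Let ext_sigma_additive : semi_sigma_additive ext.
Proof.
move=> A mA tA mUA.
rewrite (_ : ext (\bigcup_n A n) = \sum_(n <oo) ext (A n)).
  by apply: is_cvg_ereal_nneg_natsum => n _; exact: ext_ge0.
rewrite /extend_law -integral_nneseries//; last by move=> n; exact: measurable_slice.
apply: eq_integral => h _.
rewrite xsection_bigcup measure_semi_bigcup//.
- by move=> n; exact: measurable_xsection.
- exact: trivIset_xsection.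
- by apply: bigcup_measurable => n _; exact: measurable_xsection.
Qed.

HB.instance Definition _ :=
  isMeasure.Build _ _ _ ext ext0 ext_ge0 ext_sigma_additive.

Let ext_setT : ext setT = 1.
Proof.
have xT h : xsection [set: X * Y] h = setT.
  by apply/seteqP; split => // y _; rewrite /xsection/= in_setT.
transitivity (\int[P]_(h in setT) cst 1 h).
  by apply: eq_integral => h _; rewrite xT; exact: probability_setT.
by rewrite integral_cst// mul1e; exact: probability_setT.
Qed.

HB.instance Definition _ := Measure_isProbability.Build _ _ _ ext ext_setT.

End ExtendLaw.

Section Interaction.
Context (R : realType) (K : nat) (F : 'I_K -> exp_family R) (I : finType).
Context d (U : measurableType d) (T : nat) (A : algorithm R K I U T).

Fixpoint hist_law (mu : 'rV[R]_K) (t : nat) : probability (hist R U t) R :=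
  match t return probability (hist R U t) R with
  | 0 => alg_seed A
  | s.+1 => extend_law (hist_law mu s) (fun k => ef_law (F k) (mu ord0 k))
                       (@alg_arm_measurable _ _ _ _ _ _ A s)
  end.

Fixpoint pulls (k : 'I_K) (t : nat) : hist R U t -> nat :=
  match t return hist R U t -> nat with
  | 0 => fun=> 0%N
  | s.+1 => fun h => (pulls k h.1 + (alg_arm A h.1 == k))%N
  end.

Definition error_prob (istar : 'rV[R]_K -> I) (mu : 'rV[R]_K) : \bar R :=
  hist_law mu T [set h | alg_answer A h != istar mu].

Definition difficulty_ratio (istar : 'rV[R]_K -> I) (H : 'rV[R]_K -> R)
    (mu : 'rV[R]_K) : \bar R :=
  (T%:R%:E / ((H mu)%:E * lne (1 / error_prob istar mu)))%E.

End Interaction.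

(* Main.v *)
(* The divergence between the laws of the history under mu and la is
   sum_k E_mu[N_k] KL(mu_k, la_k).  Only one half of this is needed, and it is
   obtained without log-likelihood ratios of histories, by iterating the
   Donsker-Varadhan inequality
     E_P[f] <= KL(P, Q) + ln E_Q[exp f]        (0 <= f <= c)
   backwards in time: a bounded function f of the history after t + 1 rounds is
   replaced by the function h |-> ln E_la[exp f | h] of the history after t
   rounds, at the cost of the divergence of the arm pulled in between.
   All integrands stay nonnegative, so that infinite divergences need no special
   treatment.
   The choice f = c 1_E, where E is the event that the answer is wrong for la,
   gives c P_mu(E) <= sum_k E_mu[N_k] KL_k + ln (1 + P_la(E) exp c).  Then take
   c = ln (1 / P_la(E)), or let c tend to infinity if P_la(E) = 0. *)

Require Import Defs.
From HB Require Import structures.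
From mathcomp Require Import all_boot all_order all_algebra.
From mathcomp Require Import all_classical all_reals all_analysis.
From mathcomp Require Import measurable_realfun.
From mathcomp Require Import lra.

Set Implicit Arguments.
Unset Strict Implicit.
Unset Printing Implicit Defensive.

Import Order.TTheory GRing.Theory Num.Theory.
Import numFieldNormedType.Exports.

Local Open Scope classical_set_scope.
Local Open Scope ring_scope.

(** * Preliminaries on logarithms and exponential moments *)

Lemma integral_probability_cst d (X : measurableType d) (R : realType)
    (P : probability X R) (r : \bar R) : (\int[P]_x cst r x = r)%E.
Proof.
rewrite integral_cst// -[RHS]mule1; congr (_ * _)%E; exact: probability_setT.
Qed.

Lemma measurable_lne_EFin d (X : measurableType d) (R : realType) (f : X -> R) :
  measurable_fun setT f -> measurable_fun setT (fun x => lne (f x)%:E).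
Proof.
move=> mf; rewrite /lne; apply: measurable_fun_ifT => //.
- exact: measurable_fun_ler.
- by apply/measurable_EFinP; exact: measurableT_comp.
Qed.

(** This is [1 + u <= expR u] at [u = f - ln (z * M)]. With [z] a density and [M] an exponential
    moment of [f], integrating it yields the entropy inequalities below, without any convexity
    argument. *)
Lemma add1_le_ln_expR (R : realType) (f z M : R) : 0 < z -> 0 < M ->
  f + 1 <= ln z + ln M + expR f / M / z.
Proof.
move=> z0 M0; have zM0 : 0 < z * M by rewrite mulr_gt0.
have := expR_ge1Dx (f - ln (z * M)).
by rewrite expRD expRN lnK ?posrE// lnM ?posrE// invfM mulrA mulrAC; lra.
Qed.

(** Boundedness of [f] enters here: the logarithm of the exponential moment is a real number in the
    interval from 0 to [c]. *)
Lemma integral_expR_bounds d (X : measurableType d) (R : realType)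
    (P : probability X R) (f : X -> R) (c : R) :
  measurable_fun setT f -> (forall x, 0 <= f x <= c) ->
  (1 <= \int[P]_x (expR (f x))%:E <= (expR c)%:E)%E.
Proof.
move=> mf f0c; have me : measurable_fun setT (fun x => (expR (f x))%:E).
  by apply/measurable_EFinP; exact: measurableT_comp.
apply/andP; split.
- rewrite -(integral_probability_cst P 1%E); apply: ge0_le_integral => //= x _.
  by rewrite lee_fin; have /andP[f0 _] := f0c x; have := expR_ge1Dx (f x); lra.
- rewrite -(integral_probability_cst P (expR c)%:E).
  apply: ge0_le_integral => //= x _.
  by rewrite lee_fin ler_expR; have /andP[] := f0c x.
Qed.

(** * Densities, the Donsker-Varadhan inequality and Jensen's inequality *)

(** Provides one density that is real and nonnegative at every point, and that serves both to change
    variables and to compute the divergence. *)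
Lemma ge0_integral_density d (X : measurableType d) (R : realType)
    (P Q : probability X R) : P `<< Q ->
  exists r : X -> R, [/\ measurable_fun setT r, forall x, 0 <= r x,
    forall f : X -> \bar R, (forall x, 0 <= f x)%E -> measurable_fun setT f ->
      (\int[P]_x f x = \int[Q]_x (f x * (r x)%:E))%E &
    kl P Q = (\int[P]_x lne (r x)%:E)%E].
Proof.
move=> PQ; pose g := Radon_Nikodym_SigmaFinite.f P Q.
have gfin x : g x \is a fin_num by exact: Radon_Nikodym_SigmaFinite.f_fin_num.
have mg : measurable_fun setT g.
  exact: measurable_int (Radon_Nikodym_SigmaFinite.f_integrable PQ).
exists (fine \o g); split.
- exact: measurableT_comp.
- by move=> x; rewrite fine_ge0// Radon_Nikodym_SigmaFinite.f_ge0.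
- move=> f f0 mf.
  rewrite -(Radon_Nikodym_SigmaFinite.change_of_variables PQ)//.
  by apply: eq_integral => x _ /=; rewrite fineK.
- rewrite /kl; case: asboolP => // _.
  (* [h] is the derivative that occurs in [kl], [g] the one that comes with the change of variables.
     They agree [Q]-almost everywhere, hence [P]-almost everywhere by absolute continuity. *)
  set h := Radon_Nikodym _ _.
  have hfin x : h x \is a fin_num by exact: Radon_Nikodym_fin_num.
  have mh : measurable_fun setT h.
    by apply: (measurable_int Q); exact: Radon_Nikodym_integrable.
  under eq_integral do rewrite -[h _]fineK//.
  apply: ae_eq_integral => //.
  + by apply: measurable_lne_EFin; exact: measurableT_comp.
  + by apply: measurable_lne_EFin; exact: measurableT_comp.
  + have /(null_dominates_ae_eq measurableT PQ) : ae_eq Q setT g h.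
      exact: ae_eq_Radon_Nikodym_SigmaFinite.
    by apply: filterS => x /= gh _; rewrite gh.
Qed.

(** With [M] the integral of [expR f] under [Q] and [r] the density of [P], integrate
    [f + 1 <= ln r + ln M + expR f / (M r)] under [P]. The last term contributes at most 1, which
    cancels the 1 on the left. *)
Lemma donsker_varadhan d (X : measurableType d) (R : realType)
    (P Q : probability X R) (f : X -> R) (c : R) :
  measurable_fun setT f -> (forall x, 0 <= f x <= c) ->
  (\int[P]_x (f x)%:E <= kl P Q + lne (\int[Q]_x (expR (f x))%:E))%E.
Proof.
move=> mf f0c; have f0 x : 0 <= f x by have /andP[] := f0c x.
have me : measurable_fun setT (fun x => expR (f x)) by exact: measurableT_comp.
have /andP[] := integral_expR_bounds Q mf f0c.
case EM : (\int[Q]_x _)%E => [M| |]; rewrite ?leeNe_eq// !lee_fin => M1 _.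
have M0 : 0 < M by lra.
have lnM0 : 0 <= ln M by exact: ln_ge0.
rewrite lne_EFin//.
have [PQ|nPQ] := pselect (P `<< Q); last first.
  by rewrite /kl; case: asboolP => // _; rewrite addye// leey.
have [r [mr r0 int_r ->]] := ge0_integral_density PQ.
pose L x := lne (r x)%:E.
have mL : measurable_fun setT L by exact: measurable_lne_EFin.
(* The value +oo of w = 1 / r where r = 0 makes the pointwise inequality below
   hold everywhere, while w * r = 0 there. *)
pose w x : \bar R := if r x <= 0 then +oo%E else (expR (- ln (r x)))%:E.
have wE x : 0 < r x -> w x = (r x)^-1%:E.
  by move=> rx0; rewrite /w leNgt rx0 /= expRN lnK.
have mw : measurable_fun setT w.
  apply: measurable_fun_ifT => //; first exact: measurable_fun_ler.
  apply/measurable_EFinP; apply: measurableT_comp => //.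
  by apply: measurable_funN; exact: measurableT_comp.
have w0 x : (0 <= w x)%E.
  by rewrite /w; case: ifP => // _; rewrite lee_fin expR_ge0.
have wr x : (w x * (r x)%:E <= 1)%E.
  rewrite /w; case: ifPn => [rx0|]; last first.
    by rewrite -ltNge => rx0; rewrite expRN lnK// -EFinM lee_fin mulVf// gt_eqF.
  by rewrite (_ : r x = 0) ?mule0//; apply/eqP; rewrite eq_le rx0 r0.
(* The negative part of [ln r] stands on the left, so that both sides are nonnegative. Where [r]
   vanishes the right side is [+oo]. *)
have pointwise x :
    ((f x + 1)%:E + L^\- x <=
     L^\+ x + ((ln M)%:E + w x * (expR (f x) / M)%:E))%E.
  rewrite funeposE funenegE /L /w /=; case: ifPn => [_|].
    rewrite [X in (_ + (_ + X))%E]gt0_mulye ?lte_fin ?divr_gt0 ?expR_gt0//.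
    by rewrite addey ?ltNye// addey ?leey// gt_eqF// lt_max ltNy0 orbT.
  rewrite -ltNge => rx0; rewrite expRN lnK//.
  rewrite -EFinN -!EFin_max -EFinM -!EFinD lee_fin.
  have := add1_le_ln_expR (f x) rx0 M0; rewrite [_^-1 * _]mulrC.
  set a := ln (r x); set b := expR _ / _ / _.
  rewrite /Num.max; by case: ltrP => ?; case: ltrP => ?; lra.
have Lneg_w x : (L^\- x <= w x)%E.
  rewrite funenegE /L /w /=; case: ifPn => [_|]; first by rewrite leey.
  rewrite -ltNge => rx0; rewrite expRN lnK//.
  rewrite -EFinN -EFin_max lee_fin ge_max invr_ge0 r0.
  rewrite andbT -lnV ?posrE// ltW// ln_sublinear// invr_gt0//.
(* Since [ln (1 / r) <= 1 / r] and [w * r <= 1], the negative part of the log-density has a finite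
   integral and can be subtracted at the end. *)
have B1 : (\int[P]_x L^\- x <= 1)%E.
  apply: (@le_trans _ _ (\int[P]_x w x)%E).
    by apply: ge0_le_integral => //; exact: measurable_funeneg.
  rewrite int_r// -(integral_probability_cst Q 1%E).
  apply: ge0_le_integral => //.
  - by move=> x _; rewrite mule_ge0// lee_fin.
  - by apply: emeasurable_funM => //; exact/measurable_EFinP.
have meM : measurable_fun setT (fun x => (expR (f x) / M)%:E).
  by apply/measurable_EFinP; exact: measurable_funM.
have e0 x : (0 <= (expR (f x) / M)%:E :> \bar R)%E.
  by rewrite lee_fin divr_ge0 ?expR_ge0 ?ltW.
have mW : measurable_fun setT (fun x => w x * (expR (f x) / M)%:E)%E.
  exact: emeasurable_funM.
(* Passing to [Q] multiplies by [r]; as [w * r <= 1], what remains is at most the integral of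
   [expR f / M], which is 1 by the choice of [M]. *)
have W1 : (\int[P]_x (w x * (expR (f x) / M)%:E) <= 1)%E.
  rewrite int_r//; last by move=> x; rewrite mule_ge0.
  apply: (@le_trans _ _ (\int[Q]_x ((expR (f x))%:E * (M^-1)%:E))%E).
    apply: ge0_le_integral => //.
    + by move=> x _; rewrite !mule_ge0// lee_fin.
    + by apply: (emeasurable_funM mW); exact/measurable_EFinP.
    + move=> x _; rewrite muleAC -(EFinM _ M^-1) -[leRHS]mul1e.
      exact: lee_wpmul2r.
  rewrite ge0_integralZr//; last 2 first.
  - exact/measurable_EFinP.
  - by rewrite lee_fin invr_ge0 ltW.
  by rewrite EM -EFinM mulfV ?gt_eqF.
have : (\int[P]_x ((f x)%:E + (1 + L^\- x)) <=
    \int[P]_x (L^\+ x + ((ln M)%:E + w x * (expR (f x) / M)%:E)))%E.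
  apply: ge0_le_integral => //.
  - by move=> x _; rewrite !adde_ge0// lee_fin.
  - apply: emeasurable_funD; first exact/measurable_EFinP.
    by apply: emeasurable_funD => //; exact: measurable_funeneg.
  - apply: emeasurable_funD; first exact: measurable_funepos.
    by apply: emeasurable_funD.
  - by move=> x _; rewrite addeA -EFinD; exact: pointwise.
have mf' : measurable_fun setT (fun x => (f x)%:E) by exact/measurable_EFinP.
have mLp : measurable_fun setT L^\+%E by exact: measurable_funepos.
have mLn : measurable_fun setT L^\-%E by exact: measurable_funeneg.
have we0 x : (0 <= w x * (expR (f x) / M)%:E)%E by rewrite mule_ge0.
have f0' x : (0 <= (f x)%:E)%E by rewrite lee_fin.
have Lneg1_ge0 x : (0 <= 1 + L^\- x)%E by rewrite adde_ge0.
have lnMw_ge0 x : (0 <= (ln M)%:E + w x * (expR (f x) / M)%:E)%E.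
  by rewrite adde_ge0.
have mLneg1 : measurable_fun setT (fun x => 1 + L^\- x)%E.
  exact: emeasurable_funD.
have mlnMw : measurable_fun setT
    (fun x => (ln M)%:E + w x * (expR (f x) / M)%:E)%E.
  exact: emeasurable_funD.
rewrite !ge0_integralD//.
rewrite !integral_probability_cst -[(\int[P]_x lne _)%E]/(\int[P]_x L x)%E.
rewrite (integralE P setT L).
have : (0 <= \int[P]_x L^\- x)%E by exact: integral_ge0.
have : (0 <= \int[P]_x L^\+ x)%E by exact: integral_ge0.
have : (0 <= \int[P]_x (f x)%:E)%E by exact: integral_ge0.
have : (0 <= \int[P]_x (w x * (expR (f x) / M)%:E))%E by exact: integral_ge0.
(* If the positive part of the log-density has infinite integral, the divergence is [+oo] and the
   bound is trivial; otherwise all terms are real. *)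
move: B1 W1.
case: (\int[P]_x L^\- x)%E => [b| |]; rewrite ?leye_eq// lee_fin => b1.
case: (\int[P]_x (w x * _))%E => [v| |]; rewrite ?leye_eq// lee_fin => v1 _.
case: (\int[P]_x (f x)%:E)%E => [a| |] // _;
  case: (\int[P]_x L^\+ x)%E => [a'| |] // _ _.
- by rewrite -EFinN -!EFinD !lee_fin; lra.
- by move=> _; rewrite !addye// leey.
Qed.

(** The case [f = 0] of Donsker-Varadhan, where the exponential moment is 1. *)
Lemma kl_ge0 d (X : measurableType d) (R : realType) (P Q : probability X R) :
  (0 <= kl P Q)%E.
Proof.
have h0 (x : X) : 0 <= cst (0 : R) x <= 0 by rewrite !lexx.
have := donsker_varadhan P Q (@measurable_cst _ _ X R setT 0) h0.
have := integral_expR_bounds Q (@measurable_cst _ _ X R setT 0) h0.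
rewrite /= expR0 => /andP[Q1 Q1'].
rewrite (_ : \int[Q]_x 1 = 1)%E; last by apply/eqP; rewrite eq_le Q1 Q1'.
by rewrite lne1 adde0 integral0_eq.
Qed.

(** Jensen's inequality, by the same linearization with density [z = 1]. It starts the induction on
    rounds, since the seed has the same law under both problems. *)
Lemma le_integral_lne_expR d (X : measurableType d) (R : realType)
    (P : probability X R) (f : X -> R) (c : R) :
  measurable_fun setT f -> (forall x, 0 <= f x <= c) ->
  (\int[P]_x (f x)%:E <= lne (\int[P]_x (expR (f x))%:E))%E.
Proof.
move=> mf f0c.
have f0 x : (0 <= (f x)%:E)%E by rewrite lee_fin; have /andP[] := f0c x.
have me : measurable_fun setT (fun x => (expR (f x))%:E).
  by apply/measurable_EFinP; exact: measurableT_comp.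
have e0 x : (0 <= (expR (f x))%:E)%E by rewrite lee_fin expR_ge0.
have mf' : measurable_fun setT (fun x => (f x)%:E) by exact/measurable_EFinP.
have /andP[] := integral_expR_bounds P mf f0c.
case EM : (\int[P]_x _)%E => [M| |]; rewrite ?leeNe_eq// !lee_fin => M1 _.
have M0 : 0 < M by lra.
have lnM0 : 0 <= ln M by exact: ln_ge0.
have M'0 : 0 <= M^-1 by rewrite invr_ge0 ltW.
rewrite lne_EFin//.
have meM : measurable_fun setT (fun x => (expR (f x))%:E * (M^-1)%:E)%E.
  exact: emeasurable_funM.
have eM0 x : (0 <= (expR (f x))%:E * (M^-1)%:E)%E by rewrite mule_ge0.
have : (\int[P]_x ((f x)%:E + 1) <=
    \int[P]_x ((ln M)%:E + (expR (f x))%:E * (M^-1)%:E))%E.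
  apply: ge0_le_integral => //.
  - by move=> x _; rewrite adde_ge0.
  - exact: emeasurable_funD.
  - exact: emeasurable_funD.
  - move=> x _; rewrite -EFinM -!EFinD lee_fin.
    by have := add1_le_ln_expR (f x) ltr01 M0; rewrite ln1 add0r divr1.
rewrite !ge0_integralD// ge0_integralZr// EM.
rewrite !integral_probability_cst -EFinM mulfV ?gt_eqF//.
by rewrite leeD2rE.
Qed.

(** * Integration against the law of a history extended by one observation *)

Section ExtendLawIntegral.
Local Open Scope ereal_scope.
Context d d' (X : measurableType d) (Y : measurableType d') (R : realType).
Context (K : nat) (P : probability X R) (Q : 'I_K -> probability Y R).
Context (a : X -> 'I_K) (ma : forall k, measurable (a @^-1` [set k])).

(** There are finitely many arms, so a preimage is a finite union of pieces on which the arm is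
    constant. *)
Lemma measurable_fun_arm d'' (Z : measurableType d'') (f : 'I_K -> X -> Z) :
  (forall k, measurable_fun setT (f k)) ->
  measurable_fun setT (fun x => f (a x) x).
Proof.
move=> mf _ B mB; rewrite setTI.
rewrite (_ : _ @^-1` B =
    \bigcup_(k in [set: 'I_K]) (a @^-1` [set k] `&` f k @^-1` B)); last first.
  apply/seteqP; split => [x /= Bx|x [k _] /= [<-//]].
  by exists (a x).
apply: fin_bigcup_measurable => // k _; apply: measurableI => //.
by rewrite -[X in measurable X]setTI; exact: mf.
Qed.

Lemma measurable_fun_integral_arm (f : X * Y -> \bar R) :
  (forall z, 0 <= f z) -> measurable_fun setT f ->
  measurable_fun setT (fun x => \int[Q (a x)]_y f (x, y)).
Proof.
move=> f0 mf.
apply: (measurable_fun_arm (f := fun k x => \int[Q k]_y f (x, y))) => k.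
exact: measurable_fun_fubini_tonelli_F.
Qed.

(** Tonelli's theorem for a kernel with finitely many values: cut the space by the arm chosen and
    apply Tonelli for a product measure to each piece. *)
Lemma ge0_integral_extend_law (f : X * Y -> \bar R) :
  (forall z, 0 <= f z) -> measurable_fun setT f ->
  \int[extend_law P Q ma]_z f z = \int[P]_x \int[Q (a x)]_y f (x, y).
Proof.
move=> f0 mf.
pose D k := [set z : X * Y | a z.1 = k].
have mD k : measurable (D k).
  by rewrite -[D k]setTI; exact: (measurable_fst measurableT _ (ma k)).
have fE z : f z = \sum_(k < K) (f \_ (D k)) z.
  rewrite (bigD1 (a z.1))//= patchE mem_set// big1 ?adde0// => k ka.
  rewrite patchE memNset// => Dk; move: ka; rewrite -Dk eqxx//.
have fD0 k z : 0 <= (f \_ (D k)) z by rewrite patchE; case: ifP.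
have mfD k : measurable_fun setT (f \_ (D k)).
  by apply/(measurable_restrictT _ _).1 => //; exact: measurable_funTS.
transitivity (\sum_(k < K) \int[P]_x \int[Q k]_y (f \_ (D k)) (x, y));
  last first.
  rewrite -ge0_integral_sum//; last 2 first.
  - by move=> k; exact: measurable_fun_fubini_tonelli_F.
  - by move=> k x _; exact: integral_ge0.
  apply: eq_integral => x _; rewrite (bigD1 (a x))//= [X in _ + X]big1 ?adde0.
    by apply: eq_integral => y _; rewrite patchE mem_set.
  move=> k ka; apply: integral0_eq => y _.
  by rewrite patchE memNset// => Dk; move: ka; rewrite -Dk eqxx.
under eq_integral do rewrite fE.
rewrite ge0_integral_sum//; apply: eq_bigr => k _.
rewrite -(fubini_tonelli1 (m1 := P) (m2 := Q k))//.
(* On D k the law of the pair is the product measure P \x Q k. *)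
rewrite -[LHS]integral_mkcond -[RHS]integral_mkcond.
apply: eq_measure_integral => A mA AD.
rewrite /product_measure1 /=; apply: eq_integral => x _ /=.
have [->//|axk] := eqVneq (a x) k.
rewrite (_ : xsection A x = set0) ?measure0//.
apply/seteqP; split => // y; rewrite /xsection/= inE => /AD Dk.
by move: axk; rewrite -Dk eqxx.
Qed.

End ExtendLawIntegral.

(** * Change of measure along the history *)

Section ChangeOfMeasure.
Local Open Scope ereal_scope.
Context (R : realType) (K : nat) (F : 'I_K -> exp_family R) (I : finType).
Context d (U : measurableType d) (T : nat) (A : algorithm R K I U T).
Variables mu la : 'rV[R]_K.

Local Notation KL k := (ef_kl (F k) (mu ord0 k) (la ord0 k)).

(** Kept as a function of the history, before taking expectations, so that one more round adds
    exactly the divergence of the arm pulled. Extended real values accommodate infinite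
    divergences. *)
Definition history_kl t (h : hist R U t) : \bar R :=
  \sum_(k < K) (pulls A k h)%:R%:E * KL k.

Lemma measurable_pulls t k :
  measurable_fun setT (fun h : hist R U t => (pulls A k h)%:R : R).
Proof.
elim: t => [|t IH]; first exact: measurable_cst.
under eq_fun do rewrite /= natrD.
apply: measurable_funD.
  exact: (measurableT_comp IH measurable_fst).
apply: (measurableT_comp (f := fun h => (alg_arm A h == k)%:R : R)).
  exact: (measurable_fun_arm (@alg_arm_measurable _ _ _ _ _ _ A t)
    (f := fun i _ => (i == k)%:R : R)).
exact: measurable_fst.
Qed.

Lemma measurable_history_kl t : measurable_fun setT (@history_kl t).
Proof.
apply: emeasurable_sum => k; apply: emeasurable_funM => //.
by apply/measurable_EFinP; exact: measurable_pulls.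
Qed.

Lemma history_kl_ge0 t (h : hist R U t) : 0 <= history_kl h.
Proof. by apply: sume_ge0 => k _; rewrite mule_ge0// ?kl_ge0// lee_fin. Qed.

Lemma history_klS t (h : hist R U t) (x : R) :
  @history_kl t.+1 (h, x) = history_kl h + KL (alg_arm A h).
Proof.
rewrite /history_kl [in RHS](bigD1 (alg_arm A h))//= (bigD1 (alg_arm A h))//=.
rewrite eqxx natrD EFinD ge0_muleDl// ?lee_fin// mul1e -!addeA; congr (_ + _).
rewrite addeC; congr (_ + _); apply: eq_bigr => k ka.
by rewrite eq_sym (negbTE ka) addn0.
Qed.

(** Induction on [t] for all [f] with the same [c]: the function [g] replacing [f] one round earlier
    again takes values between 0 and [c]. *)
Lemma history_donsker_varadhan t (f : hist R U t -> R) (c : R) :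
  measurable_fun setT f -> (forall h, 0 <= f h <= c)%R ->
  \int[hist_law F A mu t]_h (f h)%:E <=
    \int[hist_law F A mu t]_h history_kl h
    + lne (\int[hist_law F A la t]_h (expR (f h))%:E).
Proof.
elim: t f => [|t IH] f mf f0c.
  apply: (le_trans (le_integral_lne_expR _ mf f0c)).
  by rewrite leeDr//; apply: integral_ge0 => h _; exact: history_kl_ge0.
pose a := @alg_arm _ _ _ _ _ _ A t.
pose ma := @alg_arm_measurable _ _ _ _ _ _ A t.
pose Q (nu : 'rV[R]_K) k := ef_law (F k) (nu ord0 k) : probability R R.
have f0 h : 0 <= (f h)%:E by rewrite lee_fin; have /andP[] := f0c h.
have mfE : measurable_fun setT (fun h => (f h)%:E) by exact/measurable_EFinP.
have mexp : measurable_fun setT (fun h => (expR (f h))%:E).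
  by apply/measurable_EFinP; exact: measurableT_comp.
have exp0 h : 0 <= (expR (f h))%:E by rewrite lee_fin expR_ge0.
have mfh h : measurable_fun setT (fun x => f (h, x)).
  exact: (measurableT_comp mf (measurable_pair1 h)).
have f0ch h x : (0 <= f (h, x) <= c)%R by [].
(* [G h] is the conditional expectation of [expR f] under [la] given the earlier history [h], so
   [expR g] and [expR f] have the same mean under [la]. *)
pose G h := \int[Q la (a h)]_x (expR (f (h, x)))%:E.
pose g h := ln (fine (G h)).
have Gbounds h := integral_expR_bounds (Q la (a h)) (mfh h) (f0ch h).
have expg h : (expR (g h))%:E = G h.
  have := Gbounds h; rewrite /g -/(G h).
  case: (G h) => [r| |] /=; rewrite ?leeNe_eq ?andbF// !lee_fin => /andP[r1 _].
  by rewrite lnK// posrE; exact: lt_le_trans r1.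
have mg : measurable_fun setT g.
  apply: measurableT_comp => //; apply: measurableT_comp => //.
  exact: (measurable_fun_integral_arm (Q la) ma exp0 mexp).
have g0c h : (0 <= g h <= c)%R.
  have := Gbounds h; rewrite -/(G h) -expg !lee_fin.
  by rewrite -[X in (X <= expR (g h) <= _)%R]expR0 !ler_expR.
have lneG h : lne (G h) = (g h)%:E.
  by rewrite -expg lne_EFin ?expR_gt0// expRK.
have klg0 h : 0 <= KL (a h) by exact: kl_ge0.
have mkl : measurable_fun setT (fun h => KL (a h)).
  exact: (measurable_fun_arm ma (f := fun k _ => KL k)).
rewrite /= !ge0_integral_extend_law//; last 2 first.
- by move=> z; exact: (@history_kl_ge0 t.+1).
- exact: (@measurable_history_kl t.+1).
have -> : \int[hist_law F A mu t]_h \int[Q mu (a h)]_x @history_kl t.+1 (h, x)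
  = \int[hist_law F A mu t]_h (history_kl h + KL (a h)).
  apply: eq_integral => h _; under eq_integral do rewrite history_klS.
  exact: integral_probability_cst.
have hkl0 (h : hist R U t) : 0 <= history_kl h by exact: history_kl_ge0.
have mhkl := @measurable_history_kl t.
rewrite [X in _ <= X + _]ge0_integralD//.
have -> : \int[hist_law F A la t]_h \int[Q la (a h)]_x (expR (f (h, x)))%:E =
   \int[hist_law F A la t]_h (expR (g h))%:E.
  by apply: eq_integral => h _; rewrite expg.
(* Given [h], Donsker-Varadhan for the two laws of the arm [a h] bounds the conditional mean of [f]
   under [mu]. *)
apply: (@le_trans _ _ (\int[hist_law F A mu t]_h (KL (a h) + (g h)%:E))).
apply: ge0_le_integral => //.
  - by move=> h _; exact: integral_ge0.
  - exact: (measurable_fun_integral_arm (Q mu) ma f0 mfE).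
  - by apply: emeasurable_funD => //; exact/measurable_EFinP.
  - by move=> h _; rewrite -lneG;
      exact: (donsker_varadhan _ _ (mfh h) (f0ch h)).
have gE0 h : 0 <= (g h)%:E by rewrite lee_fin; have /andP[] := g0c h.
have mgE : measurable_fun setT (fun h => (g h)%:E) by exact/measurable_EFinP.
rewrite [leLHS]ge0_integralD//.
rewrite [X in _ <= X + _]addeC -addeA.
by apply: leeD2l; exact: IH.
Qed.

End ChangeOfMeasure.

(** * Comparison of the probabilities of one event under both problems *)

Section EventBound.
Local Open Scope ereal_scope.
Context (R : realType) (K : nat) (F : 'I_K -> exp_family R) (I : finType).
Context d (U : measurableType d) (T : nat) (A : algorithm R K I U T).
Variables mu la : 'rV[R]_K.

Local Notation V := (\int[hist_law F A mu T]_h history_kl F A mu la h).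

(** Takes [f = c 1_E] and bounds [expR f] by [1 + 1_E expR c], whose mean under [la] is explicit. *)
Lemma event_probability_bound (E : set (hist R U T)) (c : R) :
  measurable E -> (0 <= c)%R ->
  c%:E * hist_law F A mu T E <=
    V + (ln (1 + fine (hist_law F A la T E) * expR c))%:E.
Proof.
move=> mE c0; pose f h : R := (c * \1_E h)%R.
have mI : measurable_fun setT (\1_E : hist R U T -> R).
  exact: measurable_indic.
have mIE : measurable_fun setT (fun h : hist R U T => (\1_E h)%:E : \bar R).
  exact/measurable_EFinP.
have IE0 (h : hist R U T) : 0 <= (\1_E h)%:E :> \bar R by rewrite lee_fin.
have mf : measurable_fun setT f by exact: measurable_funM.
have f0c h : (0 <= f h <= c)%R.
  by rewrite /f indicE; case: (_ \in _); rewrite ?mulr1 ?mulr0 ?lexx ?c0.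
have := history_donsker_varadhan F A mu la mf f0c.
rewrite /f; under eq_integral do rewrite EFinM.
rewrite ge0_integralZl//.
rewrite integral_indic// setIT => /le_trans; apply.
apply: leeD2l; set P := hist_law F A la T.
have /andP[M1 _] := integral_expR_bounds P mf f0c.
have Pfin : P E \is a fin_num by exact: fin_num_measure.
have P0 : (0 <= fine (P E))%R by rewrite fine_ge0.
have Pc0 : (0 <= fine (P E) * expR c)%R by rewrite mulr_ge0// expR_ge0.
rewrite -lne_EFin ?ltr_pwDl// lee_lne; last 2 first.
- by rewrite in_itv/= leey andbT (le_trans _ M1).
- by rewrite in_itv/= leey andbT lee_fin addr_ge0.
have mIc : measurable_fun setT
    (fun h : hist R U T => (\1_E h)%:E * (expR c)%:E : \bar R).
  exact: emeasurable_funM.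
apply: (@le_trans _ _ (\int[P]_h (1 + (\1_E h)%:E * (expR c)%:E))).
  apply: ge0_le_integral => //.
  - by apply/measurable_EFinP; exact: measurableT_comp.
  - exact: emeasurable_funD.
  - move=> h _; rewrite -EFinM -EFinD lee_fin indicE.
    by case: (_ \in _); rewrite ?mulr1 ?mulr0 ?expR0 ?mul1r ?mul0r ?addr0//
      lerDr.
have ec0 : 0 <= (expR c)%:E by rewrite lee_fin expR_ge0.
have IEc0 (h : hist R U T) : 0 <= (\1_E h)%:E * (expR c)%:E by rewrite mule_ge0.
rewrite ge0_integralD// integral_probability_cst ge0_integralZr//.
by rewrite integral_indic// setIT EFinD EFinM fineK.
Qed.

Lemma event_log_bound (E : set (hist R U T)) :
  measurable E ->
  lne (1 / hist_law F A la T E) * hist_law F A mu T E <= V + (ln 2)%:E.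
Proof.
move=> mE; have := event_probability_bound mE.
have V0 : 0 <= V by apply: integral_ge0 => h _; exact: history_kl_ge0.
have ln20 : (0 <= ln 2 :> R)%R by rewrite ln_ge0// ler1n.
have pfin : hist_law F A la T E \is a fin_num by exact: fin_num_measure.
have qfin : hist_law F A mu T E \is a fin_num by exact: fin_num_measure.
move: (probability_le1 (hist_law F A la T) mE).
rewrite -(fineK pfin) -(fineK qfin) lee_fin.
have p0 : (0 <= fine (hist_law F A la T E))%R by exact: fine_ge0.
have q0 : (0 <= fine (hist_law F A mu T E))%R by exact: fine_ge0.
move: p0 q0; set p := fine (hist_law F A la T E).
set q := fine (hist_law F A mu T E) => p0 q0 p1 bound.
have [p00|pneq0] := eqVneq p 0%R.
  rewrite p00 inver eqxx mul1e /=.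
  have [->|qneq0] := eqVneq q 0%R; first by rewrite mule0 adde_ge0.
  have q_gt0 : (0 < q)%R by rewrite lt0r qneq0.
  have -> : V = +oo; last by rewrite addye// leey.
  apply/eqyP => r r0.
  (* With [p = 0] the logarithmic term vanishes, and [c = r / q] gives [r <= V] for arbitrary
     positive [r]. *)
  have := bound (r / q)%R (divr_ge0 (ltW r0) q0).
  by rewrite p00 mul0r addr0 ln1 adde0 -EFinM divfK.
have p_gt0 : (0 < p)%R by rewrite lt0r pneq0.
rewrite inver (negbTE pneq0) mul1e lne_EFin ?invr_gt0//.
have l0 : (0 <= ln p^-1)%R by rewrite ln_ge0// invf_ge1.
(* At [c = ln p^-1] the product [p * expR c] is 1, which produces the constant [ln 2]. *)
have := bound _ l0; rewrite /= lnK ?posrE ?invr_gt0// mulfV//.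
Qed.

End EventBound.

(** * The inverse difficulty ratio and the final inequality *)

(** Turns the inverse ratio into [H log (1 / p) / T]. The conventions at 0 and [+oo] are consistent
    with this because [t] is positive and finite. *)
Lemma inve_div (R : realType) (t : R) (x : \bar R) : 0 < t -> (0 <= x)%E ->
  ((t%:E / x)^-1 = t^-1%:E * x)%E.
Proof.
move=> t0; case: x => [r| |]//.
- have [->|r0] := eqVneq r 0.
    by rewrite inver eqxx gt0_muley ?lte_fin// invey mule0.
  by rewrite inver (negbTE r0) -EFinM inver mulf_eq0 invr_eq0 (negbTE r0)
    (gt_eqF t0)/= invfM invrK.
- by rewrite invey mule0 inve0 gt0_muley// lte_fin invr_gt0.
Qed.

Theorem theorem2 (R : realType) (K : nat) (hK : (0 < K)%N)
    (F : 'I_K -> exp_family R) (I : finType) (task : id_task F I)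
    (H : 'rV[R]_K -> R) (hH : forall nu, id_dom task nu -> 0 <= H nu)
    (T : nat) (hT : (0 < T)%N)
    (mu la : 'rV[R]_K) (hmu : id_dom task mu) (hla : id_dom task la)
    (hne : id_answer task la <> id_answer task mu)
    (hHla : H la <= Num.sqrt T%:R)
    (d : measure_display) (U : measurableType d)
    (A : algorithm R K I U T) :
  ((difficulty_ratio F A (id_answer task) H la)^-1
     * (1 - error_prob F A (id_answer task) mu)
     - (ln 2 / Num.sqrt T%:R)%:E
   <= (H la)%:E
      * \sum_(k < K) 'E_(hist_law F A mu T)[fun h => ((pulls A k h)%:R / T%:R)%R]
                     * ef_kl (F k) (mu ord0 k) (la ord0 k))%E.
Proof.
pose istar := id_answer task.
pose E := [set h : hist R U T | alg_answer A h != istar la].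
have mpre (i : I) : measurable [set h : hist R U T | alg_answer A h != i].
  rewrite (_ : [set h | _] = ~` (alg_answer A @^-1` [set i])).
    by apply: measurableC; exact: alg_answer_measurable.
  by apply/seteqP; split => h /= /eqP.
have T0 : 0 < T%:R :> R by rewrite ltr0n.
have T'0 : (0 <= (T%:R^-1)%:E :> \bar R)%E by rewrite lee_fin invr_ge0 ltW.
have H0 : 0 <= H la by exact: hH.
have V0 : (0 <= \int[hist_law F A mu T]_h history_kl F A mu la h)%E.
  by apply: integral_ge0 => h _; exact: history_kl_ge0.
(* All terms are nonnegative, so sum and integral commute even when some divergences are
   infinite. *)
have sumE : (\sum_(k < K)
      'E_(hist_law F A mu T)[fun h => ((pulls A k h)%:R / T%:R)%R]
                     * ef_kl (F k) (mu ord0 k) (la ord0 k) =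
    T%:R^-1%:E * \int[hist_law F A mu T]_h history_kl F A mu la h)%E.
  have mp k : measurable_fun setT
      (fun h : hist R U T => (pulls A k h)%:R%:E : \bar R).
    by apply/measurable_EFinP; exact: measurable_pulls.
  have p0 k (h : hist R U T) : (0 <= (pulls A k h)%:R%:E :> \bar R)%E.
    by rewrite lee_fin.
  rewrite ge0_integral_sum//; last 2 first.
  - by move=> k; exact: emeasurable_funM.
  - by move=> k h _; rewrite mule_ge0// kl_ge0.
  rewrite ge0_sume_distrr; last first.
    move=> k _; apply: integral_ge0 => h _; rewrite mule_ge0//.
    exact: kl_ge0.
  apply: eq_bigr => k _.
  rewrite ge0_integralZr//; last exact: kl_ge0.
  rewrite muleA; congr (_ * _)%E; rewrite unlock.
  rewrite -ge0_integralZl//.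
  by apply: eq_integral => h _; rewrite EFinM muleC.
have ell0 : (0 <= lne (1 / error_prob F A istar la))%E.
  rewrite lne_ge0 mul1e inve_ge1 ?measure_ge0//.
  exact: probability_le1.
(* An answer that is correct for [mu] is wrong for [la], because the two correct answers differ. *)
have nerr : (1 - error_prob F A istar mu <= hist_law F A mu T E)%E.
  rewrite /error_prob -probability_setC//.
  apply: le_measure => [||h /= /negP].
  - by apply: mem_set; apply: measurableC; exact: mpre.
  - by apply: mem_set; exact: mpre.
  - by rewrite negbK => /eqP; rewrite /E /= => ->; apply/eqP => /esym.
have main := event_log_bound F A mu la (mpre (istar la)).
rewrite sumE /difficulty_ratio inve_div//; last by rewrite mule_ge0// lee_fin.
have a0 : (0 <= (T%:R^-1 * H la)%:E :> \bar R)%E.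
  by rewrite lee_fin mulr_ge0// invr_ge0 ltW.
have ln20 : 0 <= ln 2 :> R by rewrite ln_ge0// ler1n.
rewrite leeBlDr//.
rewrite [X in (_ <= X + _)%E]muleA [X in (_ <= X * _ + _)%E]muleC.
rewrite [X in (X * _ <= _)%E]muleA -EFinM -[leLHS]muleA.
apply: (@le_trans _ _ ((T%:R^-1 * H la)%:E *
    (\int[hist_law F A mu T]_h history_kl F A mu la h + (ln 2)%:E))%E).
  apply: lee_wpmul2l => //; apply: le_trans main.
  exact: lee_wpmul2l.
rewrite ge0_muleDr// ?lee_fin//; apply: leeD2l.
(* The remaining term [H la * ln 2 / T] is at most [ln 2 / sqrt T], by [H la <= sqrt T] and
   [T = (sqrt T)^2]. *)
rewrite -EFinM lee_fin mulrC ler_wpM2l// mulrC ler_pdivrMr//.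
rewrite (le_trans hHla)// -[X in _ <= _ * X](sqr_sqrtr (ltW T0)) expr2 mulrA.
by rewrite mulVf ?mul1r// gt_eqF// sqrtr_gt0.
Qed.
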